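(* Let $k\ge 1$ be an integer and $\lambda>0$ a real number. Let $\{(N(t),I(t)),\,t\ge 0\}$ be the selling/incentive process with parameters $k$ and $\lambda$ described in the context (so $N(t)=1+kI(t)$, $N(0)=1$, and the rate of gaining an incentive when $I(t)=n$ is $\lambda_n=(nk+1)\lambda$). Then for every $t\ge 0$, $N(t)$ follows a Harris distribution, namely $P_{nk+1}(t)=P\{N(t)=nk+1\}$ is given by $$P_{nk+1}(t)=\binom{(1/k)+n-1}{n}\left(e^{-t\lambda k}\right)^{1/k}\left(1-e^{-t\lambda k}\right)^n,\qquad n=0,1,2,\ldots$$
   Context: Process: $\{I(t),t\ge 0\}$ is a continuous-time stochastic process with values in $\{0,1,2,\ldots\}$, nondecreasing in $t$, with $I(0)=0$ ($I(t)$ is the number of additional incentives obtained in $(0,t]$). For a fixed integer $k\ge1$, $N(t)=1+kI(t)$ (the minimum number of articles sold in order to have $I(t)+1$ incentives), so $N(t)$ takes values in $\{1,1+k,1+2k,\ldots\}$ and $N(0)=1$. For all $t\ge 0$ and $n\ge 0$ (with $P(I(t)=n)>0$), as $\Delta t\downarrow 0$, $$P\big(I(t+\Delta t)-I(t)=r\mid I(t)=n\big)=\begin{cases}1-\lambda_n\Delta t+o(\Delta t), & r=0,\\ \lambda_n\Delta t+o(\Delta t), & r=1,\\ o(\Delta t), & r\ge 2,\end{cases}$$ where $\lambda_n=(nk+1)\lambda$, $\lambda>0$, and the $o(\Delta t)$ terms do not depend on $t$. Harris distribution: for an integer $k\ge 1$ and real $m>1$, a random variable $X$ has the Harris distribution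 $H_1(m,k,1/k)$ if $P(X=1+nk)=\binom{(1/k)+n-1}{n}\left(\frac1m\right)^{1/k}\left(1-\frac1m\right)^n$ for $n=0,1,2,\ldots$; its probability generating function is $s/(m-(m-1)s^k)^{1/k}$. Here $\binom{x+n-1}{n}=\frac{x(x+1)\cdots(x+n-1)}{n!}$ is the generalized binomial coefficient. At $t=0$ the formula is read with $0^0=1$ (degenerate case $m=1$). *)

(* Defs.v *)
From HB Require Import structures.
From mathcomp Require Import all_boot all_order all_algebra.
From mathcomp Require Import all_classical all_reals all_analysis.

Set Implicit Arguments.
Unset Strict Implicit.
Unset Printing Implicit Defensive.

Import Order.TTheory GRing.Theory Num.Theory.
Import numFieldNormedType.Exports.
Local Open Scope classical_set_scope.
Local Open Scope ring_scope.

(** The generalized binomial coefficient written "x + n - 1 choose n", i.e.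
    x (x + 1) ... (x + n - 1) / n!; the upper entry is not the argument [x]. *)
Definition rising_binomial (R : realType) (x : R) (n : nat) : R :=
  (\prod_(i < n) (x + i%:R)) / (n`!)%:R.

(** The Harris distribution H_1(m, k, 1/k). It is usually considered for m > 1;
    the value m = 1 is allowed as the degenerate case, where [0 ^+ 0 = 1] makes
    it the point mass at 1. *)
Definition harris_distributed (d : measure_display) (T : measurableType d)
    (R : realType) (P : probability T R) (X : {RV P >-> nat})
    (m : R) (k : nat) : Prop :=
  [/\ (0 < k)%N, 1 <= m &
    forall n : nat,
      P [set w | X w = (1 + n * k)%N] =
      (rising_binomial (k%:R^-1) n * (m^-1 `^ k%:R^-1) * (1 - m^-1) ^+ n)%:E].

(** Elementary conditional probability; used only when [0 < P B]. *)
Definition cond_prob (d : measure_display) (T : measurableType d)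
    (R : realType) (P : probability T R) (A B : set T) : R :=
  fine (P (A `&` B)) / fine (P B).

Definition incentive_rate (R : realType) (k : nat) (lambda : R) (n : nat) : R :=
  (n * k + 1)%:R * lambda.

(** The first-order part, in the time step [h], of the probability of gaining
    [r] incentives when [n] have been obtained. *)
Definition jump_main (R : realType) (k : nat) (lambda : R) (n r : nat) (h : R)
    : R :=
  match r with
  | 0 => 1 - incentive_rate k lambda n * h
  | 1 => incentive_rate k lambda n * h
  | _ => 0
  end.

(** Time is the half-line [0 <= t]; nothing is assumed at negative times.
    The truncated subtraction in the last field is a genuine increment since
    paths are nondecreasing; there the remainder [rem n r], and the
    range of small [h] on which the expansion holds, may depend on [n] and [r]
    but not on [t]. *)
Record selling_incentive_process (d : measure_display) (T : measurableType d)
    (R : realType) (P : probability T R) (k : nat) (lambda : R)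
    (N I : R -> {RV P >-> nat}) : Prop := {
  sip_start : forall w, I 0 w = 0%N ;
  sip_nondecreasing :
    forall (s t : R) w, 0 <= s -> s <= t -> (I s w <= I t w)%N ;
  sip_articles : forall (t : R) w, 0 <= t -> N t w = (1 + k * I t w)%N ;
  sip_jumps :
    exists rem : nat -> nat -> R -> R^o,
      (forall n r, rem n r =o_ (0^'+) (id : R -> R^o)) /\
      forall n r, \forall h \near 0^'+, forall t : R, 0 <= t ->
        (0 < P [set w | I t w = n])%E ->
        cond_prob P [set w | (I (t + h)%R w - I t w)%N = r] [set w | I t w = n]
        = jump_main k lambda n r h + rem n r h
}.

(* Main.v *)
Require Import Defs.
From HB Require Import structures.
From mathcomp Require Import all_boot all_order all_algebra.
From mathcomp Require Import all_classical all_reals all_analysis.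
From mathcomp Require Import ring lra.

Import Order.TTheory GRing.Theory Num.Theory.
Import numFieldNormedType.Exports.
Local Open Scope classical_set_scope.
Local Open Scope ring_scope.

(** Write [p n t] for the probability that [n] incentives have been obtained at
    time [t]. Paths are nondecreasing, so being at [n] at time [t + h] means
    having been at some [j <= n] at time [t] and having gained [n - j] since;
    the infinitesimal hypothesis evaluates each term, and gives
    [p n (t + h) - p n t = h * (a n.-1 * p n.-1 t - a n * p n t) + o(h)],
    where [a n] is the rate [(n k + 1) lambda] and the first product is absent
    for [n = 0]. This is the forward equation of a pure birth process
    ([uniform_right_deriv_incentive_prob]). The Harris probabilities have the
    same initial values and, because of the recurrence
    [n.+1 * binom n.+1 = (1/k + n) * binom n] between their coefficients, satisfy
    the same differential equations ([is_derive_harris_prob]).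

    What remains is uniqueness ([birth_equation_uniq]). The hypothesis only
    yields right increments, but with an error uniform in [t], and this
    uniformity replaces any discussion of continuity or two-sided
    differentiability of [p n]. By induction on [n], the difference [f] of two
    solutions at level [n] satisfies [f (t + h) = (1 - a n * h) * f t + o(h)]
    uniformly and [f 0 = 0]. Cutting [0, t] into [m] steps of length [h = t / m],
    each step is a contraction followed by an error at most [e * h], so the
    errors add up to at most [e * t], for every [e > 0]
    ([uniform_right_deriv_decay_eq0]). To enter this argument the Harris
    probabilities must satisfy the equation with a uniform error too; this
    follows from their boundedness ([uniform_right_deriv_birth]). *)

(** * Right derivatives with a uniform error *)

(** The error is uniform over the whole half-line, which is what lets the
    errors be summed over the steps of a subdivision. *)
Definition uniform_right_deriv {R : realType} (f g : R -> R) : Prop :=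
  forall e : R, 0 < e -> \forall h \near 0^'+, forall t : R, 0 <= t ->
    `|f (t + h) - f t - h * g t| <= e * h.

Lemma uniform_right_derivB {R : realType} {f1 f2 g1 g2 : R -> R} :
  uniform_right_deriv f1 g1 -> uniform_right_deriv f2 g2 ->
  uniform_right_deriv (fun t => f1 t - f2 t) (fun t => g1 t - g2 t).
Proof.
move=> D1 D2 e e0; have e20 : 0 < e / 2 by rewrite divr_gt0.
near=> h => t t0.
have -> : f1 (t + h) - f2 (t + h) - (f1 t - f2 t) - h * (g1 t - g2 t) =
  (f1 (t + h) - f1 t - h * g1 t) - (f2 (t + h) - f2 t - h * g2 t) by ring.
rewrite (le_trans (ler_normB _ _))// [e]splitr mulrDl lerD//.
  by move: t t0; near: h; exact: D1.
by move: t t0; near: h; exact: D2.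
Unshelve. all: by end_near. Qed.

(** Euler's scheme for the equation [f' = - a f]: a step of length [h] multiplies
    by [1 - a h], which lies in [0, 1], and adds an error at most [e * h]; hence
    [`|f|] grows by at most [e * h] per step, starting from [0]. *)
Lemma uniform_right_deriv_decay_eq0 {R : realType} {f : R -> R} {a : R} :
  0 <= a -> f 0 = 0 -> uniform_right_deriv f (fun t => - a * f t) ->
  forall t, 0 <= t -> f t = 0.
Proof.
move=> a0 f0 Df t; rewrite le_eqVlt => /predU1P[<-//|t0].
suff small e : 0 < e -> `|f t| <= e * t.
  apply/eqP; rewrite -normr_le0; apply/ler_addgt0Pr => e e0; rewrite add0r.
  by have := small (e / t) (divr_gt0 e0 t0); rewrite divfK ?gt_eqF.
move=> e0.
have : \forall h \near 0^'+, a * h <= 1 /\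
    forall s, 0 <= s -> `|f (s + h) - f s - h * (- a * f s)| <= e * h.
  near=> h; split; last by near: h; exact: Df.
  have h0 : 0 < h by near: h; exact: nbhs_right_gt.
  have : h <= (a + 1)^-1.
    by near: h; apply: nbhs_right_ltW; rewrite invr_gt0; lra.
  rewrite -[X in _ <= X]mul1r ler_pdivlMr; nra.
(* With [n.+1] larger than [t / r], the step [h] falls below the threshold [r]
   and [t] is exactly the point number [n.+1] of the grid. *)
case=> r /= r0 Dr; set n := Num.truncn (t / r).
set h := t / n.+1%:R.
have n0 : (0 : R) < n.+1%:R by [].
have h0 : 0 < h by rewrite divr_gt0.
have [|ah1 Dh] := Dr h _ h0.
  rewrite /= sub0r normrN gtr0_norm// /h ltr_pdivrMr// -ltr_pdivrMl// mulrC.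
  exact: truncnS_gt.
have grid m : `|f (m%:R * h)| <= e * (m%:R * h).
  elim: m => [|m IHm]; first by rewrite !mul0r f0 normr0 mulr0.
  have s0 : 0 <= m%:R * h by rewrite mulr_ge0// ltW.
  have contract : `|(1 - a * h) * f (m%:R * h)| <= `|f (m%:R * h)|.
    rewrite normrM ger0_norm; last by lra.
    by rewrite ler_piMl//; nra.
  have -> : m.+1%:R * h = m%:R * h + h by rewrite -natr1 mulrDl mul1r.
  have -> : f (m%:R * h + h) = (1 - a * h) * f (m%:R * h) +
      (f (m%:R * h + h) - f (m%:R * h) - h * (- a * f (m%:R * h))) by ring.
  rewrite (le_trans (ler_normD _ _))// mulrDr lerD ?Dh//.
  exact: le_trans contract IHm.
by have := grid n.+1; rewrite /h mulrC divfK ?gt_eqF.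
Unshelve. all: by end_near. Qed.

Lemma is_derive_continuous {R : realType} {f g : R -> R} :
  (forall t : R, is_derive t 1 f (g t)) -> continuous f.
Proof.
move=> Df t; apply/differentiable_continuous/derivable1_diffP.
by have [] := Df t.
Qed.

(** By the mean value theorem the error is [h * (g c - g t)] for some [c] between
    [t] and [t + h], hence at most [L * h ^+ 2]. *)
Lemma uniform_right_deriv_MVT {R : realType} {f g : R -> R} {L : R} :
  (forall t : R, is_derive t 1 f (g t)) ->
  (forall s t, 0 <= s -> s <= t -> `|g t - g s| <= L * (t - s)) ->
  uniform_right_deriv f g.
Proof.
move=> Df Lg e e0.
(* [`|L| + 1] is a positive Lipschitz constant, by which [e] can be divided. *)
have L1 : 0 < `|L| + 1 by rewrite ltr_wpDl.
near=> h => t t0.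
have h0 : 0 < h by near: h; exact: nbhs_right_gt.
have hL : (`|L| + 1) * h <= e.
  rewrite mulrC -ler_pdivlMr//; near: h.
  by apply: nbhs_right_ltW; rewrite divr_gt0.
have [||c] := @MVT R f g t (t + h); rewrite ?ltrDl//.
  by apply: continuous_subspaceT; exact: is_derive_continuous Df.
rewrite in_itv/= => /andP[tc cth] ->.
have -> : g c * (t + h - t) - h * g t = (g c - g t) * h by ring.
rewrite normrM (gtr0_norm h0) ler_wpM2r ?(ltW h0)//.
apply: le_trans (Lg t c t0 (ltW tc)) _.
apply: le_trans hL; have := ler_norm L; nra.
Unshelve. all: by end_near. Qed.

(** * The forward equation of a pure birth process *)

(** The net probability flow into state [n] when the rate from [n] to [n.+1] is
    [a n]: the forward equation is [p n' = birth_flow a p n]. *)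
Definition birth_flow {R : realType} (a : nat -> R) (p : nat -> R -> R)
    (n : nat) (t : R) : R :=
  (if n is m.+1 then a m * p m t else 0) - a n * p n t.

(** The system is triangular: once the solutions agree at level [n], the inflow
    terms cancel at level [n.+1] and the difference solves [f' = - a n.+1 f]. *)
Lemma birth_equation_uniq {R : realType} {a : nat -> R} {p q : nat -> R -> R} :
  (forall n, 0 <= a n) ->
  (forall n, p n 0 = q n 0) ->
  (forall n, uniform_right_deriv (p n) (birth_flow a p n)) ->
  (forall n, uniform_right_deriv (q n) (birth_flow a q n)) ->
  forall n t, 0 <= t -> p n t = q n t.
Proof.
move=> a0 pq0 Dp Dq.
have level n : (forall s, 0 <= s ->
      birth_flow a p n s - birth_flow a q n s = - a n * (p n s - q n s)) ->
    forall t, 0 <= t -> p n t = q n t.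
  move=> flow_diff t t0; apply/eqP; rewrite -subr_eq0; apply/eqP.
  apply: (uniform_right_deriv_decay_eq0 (f := fun s => p n s - q n s)
    (a0 n)) t0 => [|e e0]; first by rewrite pq0 subrr.
  apply: filterS (uniform_right_derivB (Dp n) (Dq n) e e0) => h Dh s s0.
  by rewrite -flow_diff//; exact: Dh.
by elim=> [|n IHn]; apply: level => s s0; rewrite /birth_flow ?IHn//; ring.
Qed.

(** Bounded solutions have bounded derivatives, since the equation expresses the
    derivative through the solution; so each [q m] is Lipschitz, hence so is
    each derivative, and the mean value theorem gives a uniform error. *)
Lemma uniform_right_deriv_birth {R : realType} {a c : nat -> R}
    {q : nat -> R -> R} :
  (forall n, 0 <= a n) ->
  (forall n (t : R), is_derive t 1 (q n) (birth_flow a q n t)) ->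
  (forall n t, 0 <= t -> `|q n t| <= c n) ->
  forall n, uniform_right_deriv (q n) (birth_flow a q n).
Proof.
move=> a0 Dq qc n.
have lip m : exists L, forall s t, 0 <= s -> s <= t ->
    `|q m t - q m s| <= L * (t - s).
  exists ((if m is j.+1 then a j * c j else 0) + a m * c m) => s t s0.
  rewrite le_eqVlt => /predU1P[->|st]; first by rewrite !subrr normr0 mulr0.
  have [|x] := @MVT R (q m) (birth_flow a q m) s t st (fun x _ => Dq m x).
    by apply: continuous_subspaceT; exact: is_derive_continuous (Dq m).
  rewrite in_itv/= => /andP[sx xt] ->.
  have x0 : 0 <= x by lra.
  rewrite normrM [X in _ * X]gtr0_norm ?subr_gt0// ler_wpM2r ?subr_ge0 ?(ltW st)//.
  rewrite /birth_flow (le_trans (ler_normB _ _))// lerD//.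
    by case: m => [|m]; rewrite ?normr0// normrM ger0_norm// ler_wpM2l ?qc.
  by rewrite normrM ger0_norm// ler_wpM2l ?qc.
have [L qL] := lip n.
pose inflow (x : R) := if n is m.+1 then a m * q m x else 0.
have [M FM] : exists M, forall s t, 0 <= s -> s <= t ->
    `|inflow t - inflow s| <= M * (t - s).
  rewrite /inflow; case: (n) => [|j].
    by exists 0 => *; rewrite subrr normr0 mul0r.
  have [M qM] := lip j; exists (a j * M) => s t s0 st.
  by rewrite -mulrBr normrM ger0_norm// -mulrA ler_wpM2l ?qM.
apply: (uniform_right_deriv_MVT (L := M + a n * L)) => // s t s0 st.
have -> : birth_flow a q n t - birth_flow a q n s =
    (inflow t - inflow s) - a n * (q n t - q n s).
  by rewrite /birth_flow -/(inflow s) -/(inflow t); ring.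
rewrite mulrDl (le_trans (ler_normB _ _))// lerD ?FM//.
by rewrite normrM ger0_norm// -mulrA ler_wpM2l ?qL.
Qed.

(** * The Harris probabilities solve the forward equation *)

(** The point masses of H_1(exp(lambda k t), k, 1/k), with the power [1/k] already
    carried out inside the exponential. *)
Definition harris_prob {R : realType} (k : nat) (lambda : R) (n : nat) (t : R)
    : R :=
  rising_binomial (k%:R^-1) n * expR (- (lambda * t)) *
  (1 - expR (- (lambda * k%:R * t))) ^+ n.

Lemma rising_binomialS {R : realType} (x : R) n :
  n.+1%:R * rising_binomial x n.+1 = (x + n%:R) * rising_binomial x n.
Proof.
rewrite /rising_binomial big_ord_recr/= factS natrM.
have : n`!%:R != 0 :> R by rewrite pnatr_eq0 -lt0n fact_gt0.
have : n.+1%:R != 0 :> R by [].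
by move=> *; field; apply/andP.
Qed.

Lemma rising_binomial_ge0 {R : realType} (x : R) n :
  0 <= x -> 0 <= rising_binomial x n.
Proof. by move=> x0; rewrite divr_ge0 ?prodr_ge0// => i _; rewrite addr_ge0. Qed.

Lemma harris_prob0 {R : realType} k (lambda : R) n :
  harris_prob k lambda n 0 = (n == 0%N)%:R.
Proof.
rewrite /harris_prob !mulr0 oppr0 expR0 subrr expr0n.
by case: n => [|n]; rewrite ?mulr0// /rising_binomial big_ord0 fact0 divr1 !mulr1.
Qed.

(** With [v = exp(- lambda k t)] and [w = exp(- lambda t)], differentiating
    [w * (1 - v) ^+ n] gives
    [n k lambda w v (1 - v) ^+ n.-1 - lambda w (1 - v) ^+ n]; writing [v] as
    [1 - (1 - v)] separates the outflow at rate [(n k + 1) lambda] from a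
    multiple of the mass at [n.-1]. *)
Lemma is_derive_harris_prob {R : realType} k (lambda : R) n (t : R) :
  (0 < k)%N ->
  is_derive t 1 (harris_prob k lambda n)
    (birth_flow (incentive_rate k lambda) (harris_prob k lambda) n t).
Proof.
move=> k0.
have DE (c s : R) : is_derive s 1 (fun u => expR (- (c * u)))
    (- c * expR (- (c * s))).
  have Dlin : is_derive s 1 (fun u : R => - (c * u)) (- c).
    apply: (@is_derive_eq _ _ _ _ _ _ _ _ (is_deriveN (is_deriveZ c (is_derive_id s 1)))).
    by rewrite /GRing.scale/= mulr1.
  by rewrite mulrC; exact: (is_derive1_comp (is_derive_expR _) Dlin).
have D1 := DE (lambda * k%:R) t.
have Du : is_derive t 1 (fun u => 1 - expR (- (lambda * k%:R * u)))
    (lambda * k%:R * expR (- (lambda * k%:R * t))).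
  apply: (@is_derive_eq _ _ _ _ _ _ _ _ (is_deriveB (is_derive_cst (1 : R) t 1) D1)).
  by rewrite sub0r mulNr opprK.
have Dn := is_deriveX n Du.
have D0 := is_deriveZ (rising_binomial (k%:R^-1) n) (DE lambda t).
have D := is_deriveM D0 Dn.
have qE : harris_prob k lambda n =
    rising_binomial (k%:R^-1) n *: (fun u => expR (- (lambda * u))) *
    (fun u => 1 - expR (- (lambda * k%:R * u))) ^+ n.
  by apply/funext => u; rewrite /harris_prob !fctE.
rewrite qE; apply: (is_derive_eq D).
(* Scalings occur both of functions and of their values, hence the two unfoldings. *)
rewrite !fctE /birth_flow /harris_prob /incentive_rate /GRing.scale/= /GRing.scale/=.
set v := expR (- (lambda * k%:R * t)); set w := expR (- (lambda * t)).
have kR : k%:R != 0 :> R by rewrite pnatr_eq0 -lt0n.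
case: n {D0 Dn D qE} => [|n].
  by rewrite !expr0 mul0n; ring.
have -> : ((n * k + 1)%:R : R) = k%:R * (k%:R^-1 + n%:R).
  by rewrite natrD natrM; field.
(* The intermediate expression isolates the left-hand side of the recurrence
   for the coefficients. *)
transitivity (k%:R * lambda * w * (1 - v) ^+ n *
    (n.+1%:R * rising_binomial k%:R^-1 n.+1) -
    (n.+1 * k + 1)%:R * lambda * (rising_binomial k%:R^-1 n.+1 * w * (1 - v) ^+ n.+1)).
  by rewrite !exprS natrD natrM /=; ring.
by rewrite rising_binomialS; ring.
Qed.

Lemma harris_prob_bound {R : realType} k (lambda : R) n (t : R) :
  0 <= lambda -> 0 <= t ->
  0 <= harris_prob k lambda n t <= rising_binomial (k%:R^-1) n.
Proof.
move=> l0 t0; have c0 : 0 <= rising_binomial (k%:R^-1 : R) n.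
  by rewrite rising_binomial_ge0.
have exp01 (x : R) : 0 <= x -> 0 <= expR (- x) <= 1.
  by move=> x0; rewrite expR_ge0 -expR0 ler_expR oppr_le0.
have /andP[w0 w1] := exp01 (lambda * t) (mulr_ge0 l0 t0).
have /andP[v0 v1] : 0 <= expR (- (lambda * k%:R * t)) <= 1.
  by rewrite exp01// !mulr_ge0.
have /andP[u0 u1] : 0 <= (1 - expR (- (lambda * k%:R * t))) ^+ n <= 1.
  by apply/andP; split; [apply: exprn_ge0; lra|apply: exprn_ile1; lra].
apply/andP; split; first by do 2![apply: mulr_ge0 => //].
by rewrite /harris_prob -mulrA ler_piMr// mulr_ile1.
Qed.

(** * The number of incentives solves the forward equation *)

Definition incentive_prob {d : measure_display} {T : measurableType d}
    {R : realType} {P : probability T R} (I : R -> {RV P >-> nat})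
    (n : nat) (t : R) : R :=
  fine (P [set w | I t w = n]).

Lemma measurable_event_eq {d : measure_display} {T : measurableType d}
    {R : realType} {P : probability T R} (X : {RV P >-> nat}) (n : nat) :
  measurable [set w | X w = n].
Proof. exact: (@measurable_funPTI _ _ _ _ X [set n]). Qed.

(** If [B] is null then so is the intersection, so the multiplication rule also
    holds for the conventional value of the conditional probability there. *)
Lemma cond_probMl {d : measure_display} {T : measurableType d} {R : realType}
    (P : probability T R) (A B : set T) : measurable A -> measurable B ->
  fine (P B) * cond_prob P A B = fine (P (A `&` B)).
Proof.
move=> mA mB; rewrite /cond_prob; have [PB0|PB0] := eqVneq (fine (P B)) 0.
  rewrite PB0 mul0r; apply/esym/eqP; rewrite eq_le fine_ge0// andbT -PB0.
  rewrite fine_le ?fin_num_measure//; first exact: measurableI.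
  by apply: le_measure; rewrite ?inE//; exact: measurableI.
by rewrite mulrC divfK.
Qed.

(** Total probability over the state [j] at time [t]. Since paths are
    nondecreasing only [j <= n] contribute, which makes the sum finite, and the
    truncated difference recovers [I (t + h)] from [I t]. *)
Lemma incentive_prob_step {d : measure_display} {T : measurableType d}
    {R : realType} {P : probability T R} {k : nat} {lambda : R}
    {N I : R -> {RV P >-> nat}} (n : nat) (t h : R) :
  selling_incentive_process k lambda N I -> 0 <= t -> 0 <= h ->
  incentive_prob I n (t + h) =
  \sum_(j < n.+1) incentive_prob I j t *
    cond_prob P [set w | (I (t + h)%R w - I t w)%N = (n - j)%N]
                [set w | I t w = j].
Proof.
move=> NI t0 h0.
have mono w : (I t w <= I (t + h)%R w)%N.
  by apply: (sip_nondecreasing NI) => //; rewrite lerDl.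
pose E j := [set w | I (t + h) w = n] `&` [set w | I t w = j].
have mE j : measurable (E j) by apply: measurableI; exact: measurable_event_eq.
rewrite /incentive_prob.
have -> : [set w | I (t + h) w = n] = \big[setU/set0]_(j < n.+1) E j.
  rewrite -bigcup_mkord; apply/seteqP; split => w /=.
    by move=> Iw; exists (I t w) => //=; rewrite ltnS -Iw.
  by case=> j _ [].
rewrite measure_bigsetU//; last first.
  apply/trivIsetP => i j _ _ ij; rewrite -subset0 => w [[_ /= Ei] [_ /= Ej]].
  by move: ij; rewrite -Ei -Ej eqxx.
rewrite -sum_fine => [|j _]; last exact: fin_num_measure.
apply: eq_bigr => j _; rewrite cond_probMl; last 2 first.
- have -> : [set w | (I (t + h)%R w - I t w)%N = (n - j)%N] =
      \bigcup_(i in [set: nat]) ([set w | I t w = i] `&` [set w | I (t + h) w = (i + (n - j))%N]).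
    apply/seteqP; split => w /=.
      by move=> Iw; exists (I t w) => //=; split=> //; rewrite -Iw subnKC.
    by case=> i _ [/= -> ->]; rewrite addKn.
  by apply: bigcup_measurable => i _; apply: measurableI; exact: measurable_event_eq.
- exact: measurable_event_eq.
congr (fine (P _)); apply/seteqP; split=> w [/= Iw Itw]; split=> //=.
  by rewrite Iw Itw.
by rewrite -(subnKC (mono w)) Iw Itw subnKC// -ltnS.
Qed.

(** Only the last two states [j = n] and [j = n - 1] have a nonzero first-order
    jump probability to [n]. *)
Lemma sum_jump_main {R : realType} (k : nat) (lambda : R) (p : nat -> R -> R)
    (n : nat) (t h : R) :
  \sum_(j < n.+1) p j t * jump_main k lambda j (n - j) h =
  p n t + h * birth_flow (incentive_rate k lambda) p n t.
Proof.
rewrite big_ord_recr/= subnn /=; case: n => [|n].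
  by rewrite big_ord0 /birth_flow; ring.
rewrite big_ord_recr/= subSnn /= big1 ?add0r => [|j _].
  by rewrite /birth_flow; ring.
by rewrite subSn 1?ltnW// -subnSK//= mulr0.
Qed.

(** The expansion of the jump probabilities holds for [h] below a threshold that
    depends on the state, as does the remainder; but only the finitely many
    states up to [n] lead to [n], so a common threshold exists. Each of the
    [n.+1] remainders is allotted the error [e * h / n.+1]. *)
Lemma uniform_right_deriv_incentive_prob {d : measure_display}
    {T : measurableType d} {R : realType} {P : probability T R} {k : nat}
    {lambda : R} {N I : R -> {RV P >-> nat}} (n : nat) :
  selling_incentive_process k lambda N I ->
  uniform_right_deriv (incentive_prob I n)
    (birth_flow (incentive_rate k lambda) (incentive_prob I) n).
Proof.
move=> NI e e0; have [rem [rem_o jumps]] := sip_jumps NI.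
have en0 : 0 < e / n.+1%:R by rewrite divr_gt0.
have rem_small (j : 'I_n.+1) :
    \forall h \near 0^'+, `|rem j (n - j)%N h| <= e / n.+1%:R * `|h|.
  by move/eqoP : (rem_o j (n - j)%N); exact.
near=> h.
have h0 : 0 < h by near: h; exact: nbhs_right_gt.
have rem_h (j : 'I_n.+1) : `|rem j (n - j)%N h| <= e / n.+1%:R * h.
  by rewrite -[X in _ * X]gtr0_norm//; move: j; near: h; exact: filter_forall.
have jump_h (j : 'I_n.+1) : forall t, 0 <= t ->
    (0 < P [set w | I t w = j])%E ->
    cond_prob P [set w | (I (t + h)%R w - I t w)%N = (n - j)%N]
      [set w | I t w = j] =
    jump_main k lambda j (n - j) h + rem j (n - j)%N h.
  by move: j; near: h; apply: filter_forall => j; exact: jumps.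
move=> t t0.
rewrite (incentive_prob_step n t h NI t0 (ltW h0)).
set p := incentive_prob I.
have p01 j : 0 <= p j t <= 1.
  rewrite fine_ge0//= -lee_fin fineK ?fin_num_measure//; last exact: measurable_event_eq.
  by apply: probability_le1; exact: measurable_event_eq.
rewrite -addrA -opprD -sum_jump_main -sumrB.
have -> : e * h = \sum_(j < n.+1) e / n.+1%:R * h.
  by rewrite sumr_const card_ord -mulr_natl; field.
rewrite (le_trans (ler_norm_sum _ _ _))// ler_sum// => j _.
have /andP[pj0 pj1] := p01 j.
rewrite -mulrBr normrM (ger0_norm pj0).
(* The expansion is known only for states of positive probability; the other
   terms vanish. *)
have [->|pj] := eqVneq (p j t) 0; first by rewrite mul0r mulr_ge0 ?ltW.
have Pj : (0 < P [set w | I t w = j])%E.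
  rewrite measure_gt0 -fine_eq0 ?fin_num_measure//.
  exact: measurable_event_eq.
by rewrite jump_h// addrC addKr (le_trans _ (rem_h j))// ler_piMl.
Unshelve. all: by end_near. Qed.

Theorem theorem1 (d : measure_display) (T : measurableType d) (R : realType)
  (P : probability T R) (k : nat) (lambda : R) (N I : R -> {RV P >-> nat})
  (k_ge1 : (1 <= k)%N) (lambda_gt0 : 0 < lambda)
  (NI : selling_incentive_process k lambda N I)
  (t : R) (t_ge0 : 0 <= t) :
  harris_distributed (N t) (expR (t * lambda * k%:R)) k /\
  forall n : nat,
    P [set w | N t w = (n * k + 1)%N] =
    (rising_binomial (k%:R^-1) n
     * (expR (- (t * lambda * k%:R)) `^ k%:R^-1)
     * (1 - expR (- (t * lambda * k%:R))) ^+ n)%:E.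
Proof.
have law n : P [set w | N t w = (n * k + 1)%N] =
    (rising_binomial (k%:R^-1) n
     * (expR (- (t * lambda * k%:R)) `^ k%:R^-1)
     * (1 - expR (- (t * lambda * k%:R))) ^+ n)%:E.
  have -> : [set w | N t w = (n * k + 1)%N] = [set w | I t w = n].
    apply/seteqP; split=> w /=; rewrite (sip_articles NI)// addnC mulnC.
      by move=> /addIn/eqP; rewrite eqn_pmul2r// => /eqP.
    by move=> ->.
  rewrite -[LHS]fineK ?fin_num_measure//; last exact: measurable_event_eq.
  congr (_%:E); rewrite -/(incentive_prob I n t).
  have -> : incentive_prob I n t = harris_prob k lambda n t.
    apply: (birth_equation_uniq (a := incentive_rate k lambda)) t_ge0.
    - by move=> m; rewrite mulr_ge0// ltW.
    - move=> m; rewrite harris_prob0 /incentive_prob.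
      have [->|m0] := eqVneq m 0%N.
        rewrite [X in P X](_ : _ = setT) ?probability_setT//.
        by apply/seteqP; split=> w //= _; exact: sip_start NI w.
      rewrite [X in P X](_ : _ = set0) ?measure0//.
      apply/seteqP; split=> w //=; rewrite (sip_start NI) => /eqP.
      by rewrite eq_sym (negbTE m0).
    - by move=> m; exact: uniform_right_deriv_incentive_prob NI.
    - apply: (uniform_right_deriv_birth (c := rising_binomial k%:R^-1)).
      + by move=> m; rewrite mulr_ge0// ltW.
      + by move=> m s; exact: is_derive_harris_prob.
      + move=> m s s0.
        have /andP[q0 qc] := harris_prob_bound k lambda m s (ltW lambda_gt0) s0.
        by rewrite ger0_norm.
  rewrite /harris_prob -expRM; congr (_ * expR _ * (1 - expR _) ^+ n).
    by field; rewrite pnatr_eq0 -lt0n.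
  by ring.
split=> //; split=> // [|n].
  by rewrite -expR0 ler_expR !mulr_ge0// ltW.
by rewrite -expRN addnC law.
Qed.
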